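(* Let $f\colon C\to D$ be a morphism of Banach chain complexes and let $f'\colon D'\to C'$ be its dual. (1) The induced homomorphism $H_*(f)\colon H_*(C)\to H_*(D)$ is an isomorphism of vector spaces (in all degrees) if and only if $H^*(f')\colon H^*(D')\to H^*(C')$ is an isomorphism of vector spaces (in all degrees). (2) Furthermore, if $H^*(f')\colon H^*(D')\to H^*(C')$ is an isometric isomorphism (in all degrees), then $H_*(f)\colon H_*(C)\to H_*(D)$ is also an isometric isomorphism (in all degrees).
   Context: A Banach (co)chain complex is a (co)chain complex indexed over $\mathbb{N}=\{0,1,2,\dots\}$ consisting of real Banach spaces whose (co)boundary operators are bounded linear operators. A morphism of Banach (co)chain complexes is a (co)chain map consisting of bounded linear operators. The dual of a Banach chain complex $(C,\partial)$ is the Banach cochain complex $(C',\partial')$ with $(C')^n:=(C_n)'$ the topological dual of $C_n$, equipped with the operator norm $\|g\|_\infty=\sup\{|g(c)| : c\in C_n,\ \|c\|=1\}$, and with coboundary $(\partial')^n\colon (C')^n\to (C')^{n+1}$, $g\mapsto (c\mapsto g(\partial_{n+1}(c)))$. The dual $f'$ of a morphism $f$ is given degreewise by precomposition with $f$. Homology is $H_n(C)=\ker\partial_n/\operatorname{im}\partial_{n+1}$ with the set-theoretic image (not its closure), and analogously for cohomology. $H_n(C)$ carries the semi-norm $\|\alpha\|=\inf\{\|c\| : c\in C_n,\ \partial_n(c)=0,\ [c]=\alpha\}$; the analogous definition applies to cohomology of Banach cochain complexes. ''Isometric'' means preserving these semi-norms. *)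

(* Defs.v *)
From HB Require Import structures.
From mathcomp Require Import all_boot all_order all_algebra.
From mathcomp Require Import generic_quotient ring_quotient.
From mathcomp Require Import boolp classical_sets functions reals.
From mathcomp Require Import topology normedtype sequences.

Set Implicit Arguments.
Unset Strict Implicit.
Unset Printing Implicit Defensive.

Import Order.TTheory GRing.Theory Num.Theory.
Import numFieldNormedType.Exports.

Local Open Scope classical_set_scope.
Local Open Scope ring_scope.
Local Open Scope quotient_scope.

Section BoundedOperators.
Context {R : realType}.
Implicit Types V W : normedModType R.

Definition bounded_linear_pred V W : {pred V -> W} :=
  fun f => `[< linear f /\ bounded_fun_norm f >].

Lemma bounded_linear_closed V W : submod_closed (@bounded_linear_pred V W).
Proof.
split=> [|a f g].
  apply/asboolP; split=> [b x y|r]; first by rewrite /= scaler0 addr0.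
  by exists 0 => x _; rewrite normr0.
move=> /asboolP[lf bf] /asboolP[lg bg]; apply/asboolP; split.
  move=> b x y; rewrite !fctE /= lf lg !scalerDr !scalerA.
  by rewrite (mulrC a b) addrACA.
move=> r; have [M fM] := bf r; have [N gN] := bg r.
exists (`|a| * M + N) => x xr; rewrite !fctE (le_trans (ler_normD _ _))//.
by rewrite normrZ lerD ?gN// ler_wpM2l ?fM.
Qed.

HB.instance Definition _ V W := GRing.isSubmodClosed.Build R (V -> W)
  (@bounded_linear_pred V W)
  (GRing.submod_closed_semi (@bounded_linear_closed V W)).

Record bop V W := Bop {
  bop_fun :> V -> W;
  bop_prop : bop_fun \in @bounded_linear_pred V W }.

HB.instance Definition _ V W := [isSub for @bop_fun V W].
HB.instance Definition _ V W := [Choice of bop V W by <:].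
HB.instance Definition _ V W := [SubChoice_isSubLmodule of bop V W by <:].

Lemma bop_linear V W (f : bop V W) : linear f.
Proof. by have /asboolP[] := bop_prop f. Qed.

HB.instance Definition _ V W (f : bop V W) :=
  GRing.isLinear.Build R V W _ (bop_fun f) (bop_linear f).

Lemma bop_bounded V W (f : bop V W) : bounded_fun_norm f.
Proof. by have /asboolP[] := bop_prop f. Qed.

Definition mkbop V W (f : V -> W) (lf : linear f) (bf : bounded_fun_norm f) :
  bop V W := Bop (asboolT (conj lf bf)).

Lemma bopP V W (f g : bop V W) : (forall x, f x = g x) -> f = g.
Proof. by move=> fg; apply/val_inj/funext. Qed.

Lemma bopD V W (f g : bop V W) x : (f + g) x = f x + g x. Proof. by []. Qed.
Lemma bopN V W (f : bop V W) x : (- f) x = - f x. Proof. by []. Qed.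
Lemma bopZ V W a (f : bop V W) x : (a *: f) x = a *: f x. Proof. by []. Qed.
Lemma bop0 V W x : (0 : bop V W) x = 0. Proof. by []. Qed.

Lemma bop_continuous V W (f : bop V W) : continuous f.
Proof. exact/bounded_linear_continuous/bounded_funP/bop_bounded. Qed.

(* As [sup set0 = 0], the zero space gets the norm 0. *)
Definition opnorm V W (f : bop V W) : R :=
  sup [set `|f x| | x in [set x : V | `|x| = 1]].

Lemma opnorm_has_ub V W (f : bop V W) :
  has_ubound [set `|f x| | x in [set x : V | `|x| = 1]].
Proof.
have [M fM] := bop_bounded f 1.
by exists M => _ [x /= x1 <-]; rewrite fM ?x1.
Qed.

Lemma opnorm_ge0 V W (f : bop V W) : 0 <= opnorm f.
Proof.
rewrite /opnorm; set S := [set _ | _ in _].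
have [->|/set0P[y Sy]] := eqVneq S set0; first by rewrite sup0.
apply: (le_trans _ (ub_le_sup (opnorm_has_ub f) Sy)).
by case: Sy => x _ <-.
Qed.

Lemma le_opnorm V W (f : bop V W) x : `|f x| <= opnorm f * `|x|.
Proof.
have [->|x0] := eqVneq x 0; first by rewrite linear0 !normr0 mulr0.
have nx0 : 0 < `|x| by rewrite normr_gt0.
rewrite -ler_pdivrMr//; apply: (ub_le_sup (opnorm_has_ub f)).
exists (`|x|^-1 *: x) => /=.
  by rewrite normrZ ger0_norm ?invr_ge0// mulVf// gt_eqF.
by rewrite linearZ /= normrZ ger0_norm ?invr_ge0// mulrC.
Qed.

Lemma opnorm_le V W (f : bop V W) M : 0 <= M ->
  (forall x, `|f x| <= M * `|x|) -> opnorm f <= M.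
Proof.
move=> M0 fM; rewrite /opnorm; set S := [set _ | _ in _].
have [->|/set0P S0] := eqVneq S set0; first by rewrite sup0.
apply: ge_sup => // _ [x /= x1 <-].
by rewrite (le_trans (fM x))// x1 mulr1.
Qed.

Lemma opnormD V W (f g : bop V W) : opnorm (f + g) <= opnorm f + opnorm g.
Proof.
apply: opnorm_le; first by rewrite addr_ge0 ?opnorm_ge0.
move=> x; rewrite bopD mulrDl (le_trans (ler_normD _ _))//.
by rewrite lerD ?le_opnorm.
Qed.

Lemma opnormZ V W a (f : bop V W) : opnorm (a *: f) = `|a| * opnorm f.
Proof.
have leZ b (g : bop V W) : opnorm (b *: g) <= `|b| * opnorm g.
  apply: opnorm_le; first by rewrite mulr_ge0 ?opnorm_ge0.
  by move=> x; rewrite bopZ normrZ -mulrA ler_wpM2l ?le_opnorm.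
apply/eqP; rewrite eq_le leZ /=.
have [->|a0] := eqVneq a 0; first by rewrite normr0 mul0r opnorm_ge0.
rewrite -ler_pdivlMl ?normr_gt0//.
rewrite -{1}[f]scale1r -(mulVf a0) -scalerA (le_trans (leZ _ _))//.
by rewrite normfV.
Qed.

Lemma opnorm0_eq0 V W (f : bop V W) : opnorm f = 0 -> f = 0.
Proof.
move=> f0; apply: bopP => x; apply/eqP; rewrite bop0 -normr_le0.
by rewrite (le_trans (le_opnorm f x))// f0 mul0r.
Qed.

HB.instance Definition _ V W := @Lmodule_isNormed.Build R (bop V W)
  (@opnorm V W) (@opnormD V W) (@opnormZ V W) (@opnorm0_eq0 V W).

Lemma bop_normE V W (f : bop V W) : `|f| = opnorm f. Proof. by []. Qed.

Lemma le_opnormB V W (f g : bop V W) x : `|f x - g x| <= `|f - g| * `|x|.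
Proof. exact: (le_opnorm (f - g) x). Qed.

Section Complete.
Variables (V : normedModType R) (W : completeNormedModType R).

Lemma bop_complete (F : set_system (bop V W)) :
  ProperFilter F -> cauchy F -> cvg F.
Proof.
move=> FF Fc.
have Fe (e : R) : 0 < e -> exists f : bop V W, F (ball f e).
  by move=> e0; have /cauchyP/(_ e e0) := Fc.
have evc x : cvg ((fun f : bop V W => f x) @ F).
  apply/cauchy_cvgP/cauchyP => e e0.
  have d0 : 0 < e / (`|x| + 1) by rewrite divr_gt0 ?ltr_wpDl.
  have [f Ff] := Fe _ d0; exists (f x).
  change (F [set h : bop V W | ball (f x) e (h x)]).
  apply: filterS Ff => h; rewrite -!ball_normE /= => fh.
  rewrite (le_lt_trans (le_opnormB _ _ _))//.
  apply: (@le_lt_trans _ _ (e / (`|x| + 1) * `|x|)).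
    by rewrite ler_wpM2r// ltW.
  by rewrite mulrAC ltr_pdivrMr ?ltr_wpDl// ltr_pM2l// ltrDl.
pose g x := lim ((fun f : bop V W => f x) @ F).
have gE x : (fun f : bop V W => f x) @ F --> g x by exact: evc.
have gl : linear g.
  move=> a x y; apply/cvg_lim => //.
  under eq_fun do rewrite linearP.
  by apply: cvgD (gE y); apply: cvgZ (gE x); exact: cvg_cst.
have gle f e x : 0 < e -> F (ball f e) -> `|f x - g x| <= e * `|x|.
  move=> e0 Ff.
  have cv : (fun h : bop V W => `|f x - h x|) @ F --> `|f x - g x|.
    by apply: cvg_norm; apply: cvgB => //; exact: cvg_cst.
  apply: (closed_cvg (fun r => r <= e * `|x|)) cv; first exact: closed_le.
  apply: filterS Ff => h; rewrite -ball_normE /= => fh.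
  by rewrite (le_trans (le_opnormB _ _ _))// ler_wpM2r// ltW.
have gb : bounded_fun_norm g.
  move=> r; have [f Ff] := Fe _ ltr01; have [M fM] := bop_bounded f r.
  exists (M + r) => x xr; rewrite -[g x](subrK (f x)) addrC.
  rewrite (le_trans (ler_normD _ _))// lerD ?fM// distrC.
  by rewrite (le_trans (gle _ _ x ltr01 Ff))// mul1r.
apply/cvg_ex; exists (mkbop gl gb).
apply/cvgrPdist_le => /= e e0.
have e20 : 0 < e / 2 by rewrite divr_gt0.
have [f Ff] := Fe _ e20.
apply: filterS (Ff) => h; rewrite -ball_normE /= => fh.
rewrite (splitr e) -(subrK f (mkbop gl gb)) -addrA.
rewrite (le_trans (ler_normD _ _))// lerD//; last exact: ltW.
apply: opnorm_le; first exact: ltW.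
by move=> x; rewrite bopD bopN distrC; exact: gle.
Qed.

HB.instance Definition _ := Uniform_isComplete.Build (bop V W) bop_complete.
End Complete.

End BoundedOperators.

Section Dual.
Context {R : realType}.
Implicit Types U V W : normedModType R.

Definition dual V : Type := bop V R^o.

HB.instance Definition _ V := CompleteNormedModule.copy (dual V) (bop V R^o).

Lemma bop_comp_linear U V W (g : bop V W) (f : bop U V) : linear (g \o f).
Proof. by move=> a x y /=; rewrite !linearP. Qed.

Lemma bop_comp_bounded U V W (g : bop V W) (f : bop U V) :
  bounded_fun_norm (g \o f).
Proof.
move=> r; have [M fM] := bop_bounded f r; have [N gN] := bop_bounded g M.
by exists N => x xr; rewrite gN//= fM.
Qed.

Definition bop_comp U V W (g : bop V W) (f : bop U V) : bop U W :=
  mkbop (bop_comp_linear g f) (bop_comp_bounded g f).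

Definition dual_fun V W (f : bop V W) (g : dual W) : dual V := bop_comp g f.

Lemma dual_fun_linear V W (f : bop V W) : linear (dual_fun f).
Proof. by move=> a g h; apply: bopP. Qed.

Lemma dual_fun_bounded V W (f : bop V W) : bounded_fun_norm (dual_fun f).
Proof.
move=> r; exists (r * `|f|) => g gr; apply: opnorm_le.
  by rewrite mulr_ge0// (le_trans _ gr).
move=> x; rewrite (le_trans (le_opnorm g (f x)))// -mulrA.
by rewrite ler_pM ?opnorm_ge0// le_opnorm.
Qed.

Definition dual_bop V W (f : bop V W) : bop (dual W) (dual V) :=
  mkbop (dual_fun_linear f) (dual_fun_bounded f).

Lemma dual_bopE V W (f : bop V W) (g : dual W) x : dual_bop f g x = g (f x).
Proof. by []. Qed.

End Dual.

(* Quotients [Z / (Z `&` B)] of subspaces of a normed space, with the        *)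
(* semi-norm induced by the norm; homology is the case [B] contained in [Z]. *)

Section Subquotient.
Context {R : realType}.

Record subspace_of (V : normedModType R) (Z : submodClosed V) := SubspaceOf {
  subspace_val : V;
  subspace_prop : subspace_val \in Z }.

Section Def.
Variables (V : normedModType R) (Z B : submodClosed V).

HB.instance Definition _ := [isSub for @subspace_val V Z].
HB.instance Definition _ := [Choice of subspace_of Z by <:].
HB.instance Definition _ := [SubChoice_isSubLmodule of subspace_of Z by <:].

Definition subspace_in : {pred subspace_of Z} := fun z => val z \in B.

Lemma subspace_in_closed : zmod_closed subspace_in.
Proof.
split=> [|x y xB yB]; first by have : 0 \in B := rpred0 B.
by have : val x - val y \in B 
  by rewrite -scaleN1r rpredD// rpredZ.
Qed.

HB.instance Definition _ :=
  GRing.isZmodClosed.Build (subspace_of Z) subspace_in subspace_in_closed.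

Definition subquot : Type := Quotient.quot subspace_in.

HB.instance Definition _ := GRing.Zmodule.copy subquot
  (Quotient.quot subspace_in).

Definition subquot_class (z : subspace_of Z) : subquot :=
  \pi_(Quotient.quot subspace_in) z.

Definition subquot_repr (a : subquot) : subspace_of Z :=
  repr (a : Quotient.quot subspace_in).

Lemma subquot_reprK a : subquot_class (subquot_repr a) = a.
Proof. exact: reprK. Qed.

Lemma subquot_classP z t :
  subquot_class z = subquot_class t <-> val z - val t \in B.
Proof.
split=> [/eqP|zt]; last apply/eqP.
  by rewrite /subquot_class -Quotient.idealrBE.
by rewrite /subquot_class -Quotient.idealrBE.
Qed.

Lemma subquot_classD z t :
  subquot_class (z + t) = subquot_class z + subquot_class t.
Proof. exact: (raddfD \pi_(Quotient.quot subspace_in)). Qed.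

Definition subquot_scale (a : R) (u : subquot) : subquot :=
  subquot_class (a *: subquot_repr u).

Lemma subquot_classZ a z :
  subquot_class (a *: z) = subquot_scale a (subquot_class z).
Proof.
apply/subquot_classP => /=; rewrite [val _]/= -scalerBr rpredZ//.
by apply/subquot_classP; rewrite subquot_reprK.
Qed.

Lemma subquot_scaleA a b u :
  subquot_scale a (subquot_scale b u) = subquot_scale (a * b) u.
Proof.
by rewrite -[u]subquot_reprK -!subquot_classZ scalerA.
Qed.

Lemma subquot_scale1 : left_id 1 subquot_scale.
Proof. by move=> u; rewrite -[u]subquot_reprK -subquot_classZ scale1r. Qed.

Lemma subquot_scaleDr : right_distributive subquot_scale +%R.
Proof.
move=> a u v; rewrite -[u]subquot_reprK -[v]subquot_reprK.
by rewrite -subquot_classD -!subquot_classZ scalerDr subquot_classD.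
Qed.

Lemma subquot_scaleDl u : {morph subquot_scale^~ u : a b / a + b}.
Proof.
move=> a b; rewrite -[u]subquot_reprK.
by rewrite -!subquot_classZ scalerDl subquot_classD.
Qed.

HB.instance Definition _ := GRing.Zmodule_isLmodule.Build R subquot
  subquot_scaleA subquot_scale1 subquot_scaleDr subquot_scaleDl.

Lemma subquot_class_linear : linear subquot_class.
Proof. by move=> a z t; rewrite subquot_classD subquot_classZ. Qed.

HB.instance Definition _ := GRing.isLinear.Build R (subspace_of Z) subquot _
  subquot_class subquot_class_linear.

Definition subquot_seminorm (u : subquot) : R :=
  inf [set `|val z| | z in [set z | subquot_class z = u]].

End Def.

Section Map.
Variables (V W : normedModType R) (Z B : submodClosed V) (Z' B' : submodClosed W).
Variable f : {linear V -> W}.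
Hypothesis fZ : {in Z, forall x, f x \in Z'}.
Hypothesis fB : {in B, forall x, f x \in B'}.

Definition subspace_map (z : subspace_of Z) : subspace_of Z' :=
  SubspaceOf (fZ (subspace_prop z)).

Definition subquot_map (u : subquot Z B) : subquot Z' B' :=
  subquot_class B' (subspace_map (subquot_repr u)).

Lemma subquot_mapE z :
  subquot_map (subquot_class B z) = subquot_class B' (subspace_map z).
Proof.
apply/subquot_classP; rewrite /= -linearB fB//.
by apply/subquot_classP; rewrite subquot_reprK.
Qed.

Lemma subquot_map_linear : linear subquot_map.
Proof.
move=> a u v; rewrite -[u]subquot_reprK -[v]subquot_reprK -linearP.
rewrite !subquot_mapE -linearP; congr subquot_class; apply: val_inj.
by rewrite /= linearP.
Qed.

Definition subquot_linear : {linear subquot Z B -> subquot Z' B'} :=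
  HB.pack subquot_map
    (GRing.isLinear.Build R _ _ _ subquot_map subquot_map_linear).

End Map.
End Subquotient.

Section Complexes.
Context {R : realType}.

(* [bd n] is the boundary operator from degree [n.+1] to degree [n]. *)
Record banach_chain := BanachChain {
  chain_obj :> nat -> completeNormedModType R;
  bd : forall n, bop (chain_obj n.+1) (chain_obj n);
  bd_bd : forall n x, bd n (bd n.+1 x) = 0 }.

Record banach_cochain := BanachCochain {
  cochain_obj :> nat -> completeNormedModType R;
  cobd : forall n, bop (cochain_obj n) (cochain_obj n.+1);
  cobd_cobd : forall n x, cobd n.+1 (cobd n x) = 0 }.

Record chain_mor (C D : banach_chain) := ChainMor {
  chain_mor_fun :> forall n, bop (C n) (D n);
  chain_morE : forall n x,
    chain_mor_fun n (bd C n x) = bd D n (chain_mor_fun n.+1 x) }.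

Record cochain_mor (C D : banach_cochain) := CochainMor {
  cochain_mor_fun :> forall n, bop (C n) (D n);
  cochain_morE : forall n x,
    cochain_mor_fun n.+1 (cobd C n x) = cobd D n (cochain_mor_fun n x) }.

Section DualComplex.

Lemma dual_bd_bd (C : banach_chain) n (g : dual (C n)) :
  dual_bop (bd C n.+1) (dual_bop (bd C n) g) = 0.
Proof. by apply: bopP => x; rewrite !dual_bopE bd_bd linear0. Qed.

Definition dual_chain (C : banach_chain) : banach_cochain :=
  BanachCochain (cochain_obj := fun n => dual (C n)) (@dual_bd_bd C).

Lemma dual_morE (C D : banach_chain) (f : chain_mor C D) n (g : dual (D n)) :
  dual_bop (f n.+1) (dual_bop (bd D n) g) =
  dual_bop (bd C n) (dual_bop (f n) g).
Proof. by apply: bopP => x; rewrite !dual_bopE chain_morE. Qed.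

Definition dual_mor (C D : banach_chain) (f : chain_mor C D) :
  cochain_mor (dual_chain D) (dual_chain C) :=
  @CochainMor (dual_chain D) (dual_chain C)
    (fun n => dual_bop (f n)) (dual_morE f).

End DualComplex.

Section Homology.
Variable C : banach_chain.

(* The boundary operator of degree 0 is the zero operator. *)
Definition is_cycle n : C n -> Prop :=
  if n is m.+1 return C n -> Prop then fun x => bd C m x = 0 else fun=> True.

Definition cycle n : {pred C n} := fun x => `[< is_cycle x >].

Definition boundary n : {pred C n} := fun x => `[< exists y, x = bd C n y >].

Lemma cycle_closed n : submod_closed (@cycle n).
Proof.
case: n => [|n]; first by split=> [|a x y _ _]; apply/asboolP.
split=> [|a x y /asboolP /= x0 /asboolP /= y0].
  by apply/asboolP; rewrite /= linear0.
by apply/asboolP; rewrite /= bop_linear x0 y0 scaler0 addr0.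
Qed.

Lemma boundary_closed n : submod_closed (@boundary n).
Proof.
split=> [|a _ _ /asboolP[x ->] /asboolP[y ->]]; apply/asboolP.
  by exists 0; rewrite linear0.
by exists (a *: x + y); rewrite bop_linear.
Qed.

HB.instance Definition _ n := GRing.isSubmodClosed.Build R (C n) (@cycle n)
  (GRing.submod_closed_semi (cycle_closed n)).
HB.instance Definition _ n := GRing.isSubmodClosed.Build R (C n) (@boundary n)
  (GRing.submod_closed_semi (boundary_closed n)).

Lemma boundary_cycle n : {subset @boundary n <= @cycle n}.
Proof.
case: n => [|n] _ /asboolP[y ->]; apply/asboolP => //=.
by rewrite bd_bd.
Qed.

Definition homology n : lmodType R := subquot (@cycle n) (@boundary n).

Definition homology_seminorm n (a : homology n) : R := subquot_seminorm a.

End Homology.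

Section Cohomology.
Variable C : banach_cochain.

Definition cocycle n : {pred C n} := fun x => `[< cobd C n x = 0 >].

(* The coboundary operator into degree 0 is the zero operator. *)
Definition is_coboundary n : C n -> Prop :=
  if n is m.+1 return C n -> Prop
  then fun x => exists y, x = cobd C m y else fun x => x = 0.

Definition coboundary n : {pred C n} := fun x => `[< is_coboundary x >].

Lemma cocycle_closed n : submod_closed (@cocycle n).
Proof.
split=> [|a x y /asboolP x0 /asboolP y0]; apply/asboolP.
  by rewrite linear0.
by rewrite bop_linear x0 y0 scaler0 addr0.
Qed.

Lemma coboundary_closed n : submod_closed (@coboundary n).
Proof.
case: n => [|n]; split.
- exact/asboolP.
- move=> a x y /asboolP /= -> /asboolP /= ->; apply/asboolP.
  by rewrite /= scaler0 addr0.
- by apply/asboolP; exists 0; rewrite linear0.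
- move=> a x y /asboolP /= [s ->] /asboolP /= [t ->]; apply/asboolP.
  by exists (a *: s + t); rewrite bop_linear.
Qed.

HB.instance Definition _ n := GRing.isSubmodClosed.Build R (C n) (@cocycle n)
  (GRing.submod_closed_semi (cocycle_closed n)).
HB.instance Definition _ n := GRing.isSubmodClosed.Build R (C n) (@coboundary n)
  (GRing.submod_closed_semi (coboundary_closed n)).

Lemma coboundary_cocycle n : {subset @coboundary n <= @cocycle n}.
Proof.
case: n => [|n] x /asboolP /=; first by move=> ->; rewrite rpred0.
by move=> [y ->]; apply/asboolP; rewrite cobd_cobd.
Qed.

Definition cohomology n : lmodType R := subquot (@cocycle n) (@coboundary n).

Definition cohomology_seminorm n (a : cohomology n) : R := subquot_seminorm a.

End Cohomology.

Section InducedMaps.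

Lemma chain_mor_cycle (C D : banach_chain) (f : chain_mor C D) n :
  {in @cycle C n, forall x, f n x \in @cycle D n}.
Proof.
case: n => [|n] x /asboolP /= x0; apply/asboolP => //=.
by rewrite -chain_morE x0 linear0.
Qed.

Lemma chain_mor_boundary (C D : banach_chain) (f : chain_mor C D) n :
  {in @boundary C n, forall x, f n x \in @boundary D n}.
Proof.
move=> _ /asboolP[y ->]; apply/asboolP.
by exists (f n.+1 y); rewrite chain_morE.
Qed.

Definition homology_map (C D : banach_chain) (f : chain_mor C D) n :
  {linear homology C n -> homology D n} :=
  subquot_linear (@chain_mor_cycle C D f n) (@chain_mor_boundary C D f n).

Lemma cochain_mor_cocycle (C D : banach_cochain) (f : cochain_mor C D) n :
  {in @cocycle C n, forall x, f n x \in @cocycle D n}.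
Proof.
move=> x /asboolP x0; apply/asboolP.
by rewrite -cochain_morE x0 linear0.
Qed.

Lemma cochain_mor_coboundary (C D : banach_cochain) (f : cochain_mor C D) n :
  {in @coboundary C n, forall x, f n x \in @coboundary D n}.
Proof.
case: n => [|n] x /asboolP /=.
  by move=> ->; rewrite linear0; apply/asboolP.
move=> [y ->]; apply/asboolP.
by exists (f n y); rewrite cochain_morE.
Qed.

Definition cohomology_map (C D : banach_cochain) (f : cochain_mor C D) n :
  {linear cohomology C n -> cohomology D n} :=
  subquot_linear (@cochain_mor_cocycle C D f n) (@cochain_mor_coboundary C D f n).

End InducedMaps.

Definition homology_iso (C D : banach_chain) (f : chain_mor C D) : Prop :=
  forall n, bijective (homology_map f n).

Definition homology_isometric (C D : banach_chain) (f : chain_mor C D) : Prop :=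
  forall n a, homology_seminorm (homology_map f n a) = homology_seminorm a.

Definition cohomology_iso (C D : banach_cochain) (f : cochain_mor C D) : Prop :=
  forall n, bijective (cohomology_map f n).

Definition cohomology_isometric (C D : banach_cochain) (f : cochain_mor C D) :
    Prop :=
  forall n a, cohomology_seminorm (cohomology_map f n a) = cohomology_seminorm a.

End Complexes.

Arguments banach_chain R : clear implicits.
Arguments banach_cochain R : clear implicits.

(* Main.v *)
Require Import Defs.
From HB Require Import structures.
From mathcomp Require Import all_boot all_order all_algebra.
From mathcomp Require Import boolp classical_sets functions reals.
From mathcomp Require Import prodnormedzmodule topology normedtype sequences.
From mathcomp Require Import lra.

(** Let E be the mapping cone of f, with E_0 = D_0 and
    E_(n+1) = C_n * D_(n+1).  A diagram chase shows that f is an isomorphism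
    in homology exactly when E is acyclic ([homology_isoP], [acyclic_cone]),
    and the same chase in the dual complexes, together with the fact that a
    functional on a product is a pair of functionals, shows that f' is an
    isomorphism in cohomology exactly when E' is acyclic ([cohomology_isoP],
    [coacyclic_cone]).  This reduces (1) to the statement that a Banach chain
    complex E is acyclic if and only if its dual is.

    If E is acyclic, the open mapping theorem bounds the preimages under each
    boundary operator, so a cocycle g satisfies |g x| <= K |bd x|, and the
    Hahn-Banach theorem factors g through bd ([acyclic_coacyclic]).
    Conversely, let E' be acyclic.  The open mapping theorem, now for the
    coboundary operators, bounds by K |y| the value at a cycle y of every
    functional h with |h (bd x)| <= |x|.  By convex duality
    ([fenchel_functional]) the infimum over x of |x| + M |y - bd x| is then at
    most K |y| for all M.  For M large this gives an approximate preimage of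
    y, and successive approximation an exact one ([lift_of_dual_bound],
    [coacyclic_acyclic]).  The open mapping theorem is itself obtained from
    the same lemma, the dual bound coming from the uniform boundedness
    principle.

    For (2), the same duality, applied to the distance of a cycle z from the
    boundaries, gives a cocycle g of norm at most 1 whose value at z is at
    least the semi-norm of the class of z ([norming_cocycle]), while the
    pairing of a cohomology class with a homology class is at most the product
    of their semi-norms ([pairing_le]).  So the semi-norm on homology is determined by
    the one on cohomology, and an isometric isomorphism f' forces f to be
    isometric. *)

Set Implicit Arguments.
Unset Strict Implicit.
Unset Printing Implicit Defensive.

Import Order.TTheory GRing.Theory Num.Theory.
Import numFieldNormedType.Exports.

Local Open Scope classical_set_scope.
Local Open Scope ring_scope.

(** * Sublinear functionals and the Hahn-Banach theorem *)

Section Sublinear.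
Context {R : realType}.

Definition sublinear (V : lmodType R) (q : V -> R) : Prop :=
  (forall x y, q (x + y) <= q x + q y) /\
  (forall t x, 0 < t -> q (t *: x) <= t * q x).

Section Theory.
Variables (V : lmodType R) (q : V -> R).
Hypothesis sq : sublinear q.

Lemma sublinear0 : q 0 = 0.
Proof.
have [qD qZ] := sq.
have h2 : (0 : R) < 2^-1 by rewrite invr_gt0.
have := qD 0 0; have := qZ _ 0 h2; rewrite addr0 scaler0; lra.
Qed.

Lemma sublinearZ t x : 0 <= t -> q (t *: x) = t * q x.
Proof.
have [_ qZ] := sq.
rewrite le_eqVlt => /orP[/eqP <-|t0]; first by rewrite scale0r mul0r sublinear0.
apply/eqP; rewrite eq_le qZ//=.
rewrite -ler_pdivlMl//.
by rewrite -{1}[x](scalerK (lt0r_neq0 t0)) qZ// invr_gt0.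
Qed.

Lemma sublinearN x : - q (- x) <= q x.
Proof.
have [qD _] := sq; have := qD x (- x); rewrite subrr sublinear0; lra.
Qed.

End Theory.

(** The infimal convolution of [q] with the image of [p] under [L].  Taking
    the supremum of the linear functionals below it is convex duality; every
    use of the Hahn-Banach theorem below goes through it. *)
Definition infconv (U V : lmodType R) (L : U -> V) (p : U -> R) (q : V -> R)
  (x : V) : R := inf (range (fun u => p u + q (x - L u))).

Section InfConv.
Variables (U V : lmodType R) (L : {linear U -> V}) (p : U -> R) (q : V -> R).
Hypotheses (sp : sublinear p) (sq : sublinear q).
Hypothesis pq0 : forall u, 0 <= p u + q (- L u).

Let lb x : has_lbound (range (fun u => p u + q (x - L u))).
Proof.
exists (- q (- x)) => _ [u _ <-].
have [qD _] := sq; have := qD (x - L u) (- x); have := pq0 u.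
rewrite addrAC subrr add0r; lra.
Qed.

Lemma infconv_le x u : infconv L p q x <= p u + q (x - L u).
Proof. by apply: ge_inf; [exact: lb|exists u]. Qed.

Lemma infconv_ge x c :
  (forall u, c <= p u + q (x - L u)) -> c <= infconv L p q x.
Proof.
move=> h; apply: lb_le_inf; first by exists (p 0 + q (x - L 0)), 0.
by move=> _ [u _ <-].
Qed.

Lemma infconv_sublinear : sublinear (infconv L p q).
Proof.
have [[pD pZ] [qD qZ]] := (sp, sq); split=> [x y|t x t0].
  rewrite -lerBlDr; apply: infconv_ge => u.
  rewrite lerBlDr -lerBlDl; apply: infconv_ge => v.
  rewrite lerBlDr; apply: le_trans (infconv_le _ (u + v)) _.
  rewrite linearD opprD addrACA.
  have := pD u v; have := qD (x - L u) (y - L v); lra.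
rewrite -ler_pdivrMl//; apply: infconv_ge => u; rewrite ler_pdivrMl//.
apply: le_trans (infconv_le _ (t *: u)) _.
by rewrite linearZ -scalerBr mulrDr lerD ?pZ ?qZ.
Qed.

End InfConv.

Lemma infconv_dom (U V : lmodType R) (L : {linear U -> V}) p (q : V -> R) x :
  sublinear p -> sublinear q -> (forall u, 0 <= p u + q (- L u)) ->
  infconv L p q x <= q x.
Proof.
move=> sp sq pq0; apply: (le_trans (infconv_le sq pq0 x 0)).
by rewrite sublinear0// linear0 add0r subr0.
Qed.

Section Minimal.
Variables (V : lmodType R).

Definition dominated (p q : V -> R) := forall x, q x <= p x.

Let ray (x0 : V) (t : R^o) : V := - ((t : R) *: x0).

Let ray_linear x0 : linear (ray x0).
Proof. by move=> a s t; rewrite /ray scalerDl -scalerA opprD scalerN. Qed.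

Let rayL x0 : {linear R^o -> V} := HB.pack (ray x0)
  (GRing.isLinear.Build _ _ _ _ (ray x0) (ray_linear x0)).

Let slope (q : V -> R) (x0 : V) (t : R^o) : R := - ((t : R) * q x0).

Let slope_sublinear q x0 : sublinear (slope q x0).
Proof.
by split=> [s t|s t _]; rewrite /slope ?mulrDl ?opprD// -mulrA mulrN.
Qed.

Let slope_ge0 q x0 : sublinear q ->
  forall t, 0 <= slope q x0 t + q (- rayL x0 t).
Proof.
move=> sq t; rewrite /slope /= /ray opprK.
have [t0|t0] := leP 0 (t : R).
  by rewrite (sublinearZ sq)// addNr.
have nt : 0 <= - (t : R) by rewrite oppr_ge0 ltW.
have := sublinearN sq ((t : R) *: x0).
rewrite -scaleNr (sublinearZ sq)//; lra.
Qed.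

(** The witness is the infimum over real t of q (x + t x0) - t q x0, the
    infimal convolution of [q] with minus its own slope along the line spanned
    by [x0]; the term t = 1 gives the last bound.  Allowing t < 0 does not
    lower the infimum, by subadditivity. *)
Lemma sublinear_shift q x0 : sublinear q ->
  exists r, [/\ sublinear r, dominated q r &
    forall x, r x <= q (x + x0) - q x0].
Proof.
move=> sq; exists (infconv (rayL x0) (slope q x0) q); split.
- by apply: infconv_sublinear => //; exact: slope_ge0.
- by move=> x; apply: infconv_dom => //; exact: slope_ge0.
- move=> x; apply: (le_trans (infconv_le sq (slope_ge0 x0 sq) x 1)).
  by rewrite /= /ray /slope mul1r scale1r opprK addrC.
Qed.

(** By minimality the functional given by [sublinear_shift] equals [q], which
    makes [q] superadditive. *)
Lemma minimal_sublinear_linear q : sublinear q ->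
  (forall r, sublinear r -> dominated q r -> dominated r q) ->
  linear (q : V -> R^o).
Proof.
move=> sq qmin.
have qD x y : q (x + y) = q x + q y.
  apply/eqP; rewrite eq_le sq.1/=.
  have [r [sr rq rx]] := sublinear_shift y sq.
  have := qmin _ sr rq x; have := rx x; lra.
have qN x : q (- x) = - q x.
  have := qD x (- x); rewrite subrr sublinear0//; lra.
move=> a x y; rewrite qD; congr (_ + _).
have [a0|a0] := leP 0 a; first exact: sublinearZ.
have na : 0 <= - a by rewrite oppr_ge0 ltW.
have := sublinearZ sq x na; rewrite scaleNr qN mulNr => /oppr_inj ->.
by [].
Qed.

(** Zorn's lemma: a chain is bounded below by its pointwise infimum, which is
    finite because every sublinear r below p satisfies r x >= - p (- x), and
    subadditive because two members of a chain are comparable. *)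
Lemma exists_minimal_sublinear (p : V -> R) : sublinear p -> exists q,
  [/\ sublinear q, dominated p q &
      forall r, sublinear r -> dominated q r -> dominated r q].
Proof.
move=> sp.
pose T := {q : V -> R | sublinear q /\ dominated p q}.
pose le (q r : T) := `[< dominated (sval q) (sval r) >].
have t0 : T by exists p; split=> // x.
have qlb (q : T) x : - p (- x) <= sval q x.
  case: q => /= q [sq qp].
  by have := sublinearN sq x; have := qp (- x); lra.
have [||A Atot|[q [sq qp]] qmin] := @ZL_preorder T t0 le.
- by move=> q; apply/asboolP.
- move=> q r s /asboolP rq /asboolP qs; apply/asboolP => x.
  exact: le_trans (qs x) (rq x).
- have [A0|/set0P[a Aa]] := eqVneq A set0.
    by exists t0 => s; rewrite A0.
  pose S x := [set sval q x | q in A].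
  have lbS x : has_lbound (S x) by exists (- p (- x)) => _ [q _ <-].
  pose m x := inf (S x).
  have mle q x : A q -> m x <= sval q x.
    by move=> Aq; apply: ge_inf => //; exists q.
  have mge x c : (forall q, A q -> c <= sval q x) -> c <= m x.
    move=> h; apply: lb_le_inf; first by exists (sval a x), a.
    by move=> _ [q Aq <-]; exact: h.
  have sm : sublinear m.
    split=> [x y|t x t0'].
      rewrite -lerBlDr; apply: (mge _ _) => q Aq; rewrite lerBlDr -lerBlDl.
      apply: (mge _ _) => r Ar; rewrite lerBlDr.
      have [/asboolP qr|/asboolP qr] := Atot _ _ Aq Ar.
        have := mle _ (x + y) Ar; have := qr x.
        have := (svalP r).1.1 x y; lra.
      have := mle _ (x + y) Aq; have := qr y.
      have := (svalP q).1.1 x y; lra.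
    rewrite -ler_pdivrMl//; apply: (mge _ _) => q Aq; rewrite ler_pdivrMl//.
    by apply: (le_trans (mle _ _ Aq)); exact: (svalP q).1.2.
  have mp : dominated p m.
    by move=> x; exact: le_trans (mle _ x Aa) ((svalP a).2 x).
  exists (exist _ m (conj sm mp)) => q Aq; apply/asboolP => x /=.
  exact: mle.
exists q; split=> // r sr rq.
have rp : dominated p r by move=> x; exact: le_trans (rq x) (qp x).
exact/asboolP/(qmin (exist _ r (conj sr rp)))/asboolP.
Qed.

(** The minimal functional is taken below the one that [sublinear_shift]
    provides at [x0]: as that one is at most - p x0 at - x0, the linear
    functional attains [p] at [x0]. *)
Theorem hahn_banach (p : V -> R) (x0 : V) : sublinear p ->
  exists g : V -> R^o, [/\ linear g, dominated p g & p x0 <= g x0].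
Proof.
move=> sp; have [r [sr rp rx0]] := sublinear_shift x0 sp.
have [g [sg gr /(minimal_sublinear_linear sg) gl]] :=
  exists_minimal_sublinear sr.
exists g; split=> //; first by move=> x; exact: le_trans (gr x) (rp x).
have := gr (- x0); have := rx0 (- x0).
rewrite addNr sublinear0//.
have -> : g (- x0) = - g x0.
  have := gl (-1) x0 0.
  by rewrite addr0 !scaleN1r (sublinear0 sg) addr0.
lra.
Qed.

End Minimal.
End Sublinear.

(** * Bounded functionals, duality and the open mapping theorem *)

Section Functionals.
Context {R : realType}.

Lemma dominated_norm (V : normedModType R) (g : V -> R^o) M : linear g ->
  (forall x, g x <= M * `|x|) -> forall x, `|g x| <= M * `|x|.
Proof.
move=> lg gM x; rewrite ler_norml gM andbT.
have gN : g (- x) = - g x.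
  have g0 : g 0 = 0.
    by have := lg (-1) 0 0; rewrite scaler0 addr0 scaleN1r addNr.
  by have := lg (-1) x 0; rewrite addr0 !scaleN1r g0 addr0.
by rewrite lerNl -gN (le_trans (gM _))// normrN.
Qed.

Lemma norm_bound_bounded (V W : normedModType R) (g : V -> W) M : 0 <= M ->
  (forall x, `|g x| <= M * `|x|) -> bounded_fun_norm g.
Proof.
move=> M0 gM r; exists (M * r) => x xr.
by rewrite (le_trans (gM x))// ler_wpM2l.
Qed.

Lemma norm_sublinear (V : normedModType R) M : 0 <= M ->
  sublinear (fun x : V => M * `|x|).
Proof.
move=> M0; split=> [x y|t x t0]; first by rewrite -mulrDr ler_wpM2l// ler_normD.
by rewrite normrZ gtr0_norm// mulrCA.
Qed.

(** The functional is dominated by the infimal convolution of [p] with M |.|.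
    The latter lies below M |.|, hence the norm bound, and below [p] on the
    range of [A].  With p linear it extends a functional given on the range of
    [A], with p = 0 it computes the distance to that range, and with p = |.|
    it finds approximate preimages under [A]. *)
Lemma fenchel_functional (X Y : normedModType R) (A : bop X Y) (p : X -> R)
    M y0 :
  sublinear p -> 0 <= M -> (forall x, 0 <= p x + M * `|A x|) ->
  exists h : dual Y, [/\ forall x, h (A x) <= p x, `|h| <= M &
    infconv A p (fun y => M * `|y|) y0 <= h y0].
Proof.
move=> sp M0 pM; pose q (y : Y) := M * `|y|.
have sq : sublinear q by exact: norm_sublinear.
have pq0 x : 0 <= p x + q (- A x) by rewrite /q normrN.
have [g [gl gle ge]] := hahn_banach y0 (infconv_sublinear sp sq pq0).
have gM : forall y, `|g y| <= M * `|y|.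
  apply: dominated_norm => // y.
  by apply: (le_trans (gle y)); exact: infconv_dom.
exists (mkbop gl (norm_bound_bounded M0 gM)); split=> //.
  move=> x; apply: (le_trans (gle _)).
  apply: (le_trans (infconv_le sq pq0 _ x)).
  by rewrite subrr (sublinear0 sq) addr0.
exact: opnorm_le.
Qed.

(** The errors decrease geometrically, so the partial corrections form an
    absolutely convergent series. *)
Lemma successive_approximation (X : completeNormedModType R)
    (Y : normedModType R) (A : bop X Y) (S : set Y) (K : R) :
  0 <= K ->
  (forall y, S y -> exists x, [/\ S (y - A x), `|x| <= K * `|y| &
    `|y - A x| <= 2^-1 * `|y|]) ->
  forall y, S y -> exists x, A x = y /\ `|x| <= 2 * (K * `|y|).
Proof.
move=> K0 appr y Sy.
have /choice[s sP] y' : exists x, S y' -> [/\ S (y' - A x), `|x| <= K * `|y'| &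
    `|y' - A x| <= 2^-1 * `|y'|].
  have [/appr[x]|nS] := pselect (S y'); first by exists x.
  by exists 0.
pose r := fix r n := if n is m.+1 then r m - A (s (r m)) else y.
have rS n : S (r n) by elim: n => //= n /sP[].
have rn n : `|r n| <= `|y| * 2^-1 ^+ n.
  elim: n => [|n IHn] /=; first by rewrite mulr1.
  have [_ _ /le_trans] := sP _ (rS n); apply.
  by rewrite exprS mulrCA ler_wpM2l ?invr_ge0.
pose u n := s (r n).
have un n : `|u n| <= K * `|y| * 2^-1 ^+ n.
  have [_ /le_trans + _] := sP _ (rS n); apply.
  by rewrite -mulrA ler_wpM2l.
have su n : A (series u n) = y - r n.
  elim: n => [|n IHn]; first by rewrite /series /= big_geq// linear0 subrr.
  by rewrite seriesSr linearD /= IHn opprB [RHS]addrCA [LHS]addrC.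
have h1 : `|2^-1 : R| < 1 by rewrite gtr0_norm ?invr_gt0// invf_lt1// ltr1n.
have cu : cvgn (series u).
  apply: normed_cvg; apply: (series_le_cvg _ _ un) => [n|n|].
  - exact: normr_ge0.
  - by rewrite mulr_ge0// ?exprn_ge0 ?mulr_ge0// invr_ge0.
  - exact: is_cvg_geometric_series.
have r0 : r @ \oo --> 0.
  apply/norm_cvg0P.
  apply: (@squeeze_cvgr _ _ _ _ (cst 0) (geometric `|y| 2^-1)).
  - by apply: nearW => n; rewrite normr_ge0 rn.
  - exact: cvg_cst.
  - exact: cvg_geometric.
exists (limn (series u)); split.
  have Ac : A \o series u @ \oo --> A (limn (series u)).
    by apply: continuous_cvg => //; exact: bop_continuous.
  have Ay : A \o series u @ \oo --> y.
    rewrite (_ : A \o series u = fun n => y - r n); last exact/funext.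
    by rewrite -[X in _ --> X]subr0; apply: cvgB => //; exact: cvg_cst.
  by rewrite -(cvg_lim _ Ac)// -(cvg_lim _ Ay).
have sn n : `|series u n| <= 2 * (K * `|y|) * (1 - 2^-1 ^+ n).
  elim: n => [|n IHn].
    by rewrite /series /= big_geq// normr0 subrr mulr0.
  rewrite seriesSr (le_trans (ler_normD _ _))//.
  have := un n; move: IHn; rewrite exprS.
  move: (K * `|y|) (2^-1 ^+ n) => a b; lra.
have cn : (fun n => `|series u n|) @ \oo --> `|limn (series u)|.
  exact: cvg_norm.
apply: (closed_cvg (fun t => t <= 2 * (K * `|y|))) cn; first exact: closed_le.
apply: nearW => n /=; apply: (le_trans (sn n)).
by rewrite ler_piMr ?mulr_ge0// gerBl exprn_ge0// invr_ge0.
Qed.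

(** The polar set of the image of the unit ball consists of the [h] with
    h \o A <= |.|; a bound for these on the kernel of [B] shows, by duality,
    that every y in the kernel is approximated by some A x with x of
    controlled norm. *)
Lemma lift_of_dual_bound (X : completeNormedModType R) (Y W : normedModType R)
    (A : bop X Y) (B : bop Y W) (K : R) :
  (forall x, B (A x) = 0) -> 0 <= K ->
  (forall h : dual Y, (forall x, h (A x) <= `|x|) ->
     forall y, B y = 0 -> h y <= K * `|y|) ->
  forall y, B y = 0 -> exists x, A x = y /\ `|x| <= 2 * ((K + 1) * `|y|).
Proof.
move=> BA K0 hK; apply: successive_approximation => [|y By].
  by rewrite addr_ge0.
have [->|y0] := eqVneq y 0.
  by exists 0; rewrite linear0 subr0 !normr0 !mulr0 linear0.
(* |x| + M |y - A x| < (K + 1) |y| with this M halves the error. *)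
pose M := 2 * (K + 1).
have M0 : 0 <= M by rewrite mulr_ge0// addr_ge0.
have ns : sublinear (fun x : X => `|x|).
  by split=> [x z|t x t0]; rewrite ?ler_normD// normrZ gtr0_norm.
have nM x : 0 <= `|x| + M * `|A x| by rewrite addr_ge0// mulr_ge0.
have [h [hA _ hy]] := fenchel_functional y ns M0 nM.
have ny : 0 < `|y| by rewrite normr_gt0.
have lt : infconv A (fun x => `|x|) (fun y => M * `|y|) y < (K + 1) * `|y|.
  by apply: (le_lt_trans hy); apply: (le_lt_trans (hK h hA y By)); lra.
have [x xy] : exists x, `|x| + M * `|y - A x| < (K + 1) * `|y|.
  apply: contrapT => /forallNP nx; move: lt; apply/negP; rewrite -leNgt.
  by apply: infconv_ge => x; rewrite leNgt; apply/negP; exact: nx.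
exists x; split.
- by rewrite linearB /= By BA subrr.
- apply: le_trans (ltW xy); rewrite lerDl mulr_ge0//.
- have K1 : 0 < K + 1 by rewrite ltr_wpDl.
  rewrite -(ler_pM2l K1).
  have : M * `|y - A x| <= (K + 1) * `|y|.
    by apply: le_trans (ltW xy); rewrite lerDr.
  rewrite /M -mulrA; lra.
Qed.

(** The Banach-Steinhaus theorem is about functionals on a Banach space; to
    use it on the kernel of a bounded operator, the kernel is made into a
    Banach space of its own. *)
Section Kernel.
Variables (V : completeNormedModType R) (W : normedModType R) (B : bop V W).

Definition bker : {pred V} := fun x => B x == 0.

Lemma bker_closed : submod_closed bker.
Proof.
split=> [|a x y /eqP x0 /eqP y0]; apply/eqP; first exact: linear0.
by rewrite bop_linear x0 y0 scaler0 addr0.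
Qed.

HB.instance Definition _ := GRing.isSubmodClosed.Build R V bker
  (GRing.submod_closed_semi bker_closed).

(** The alias keeps the norm and topology off [subspace_of], whose instances
    serve all subspaces, closed or not. *)
Definition kernel : Type := subspace_of bker.

HB.instance Definition _ := GRing.Lmodule.copy kernel (subspace_of bker).

Definition kernel_val (x : kernel) : V := subspace_val x.

Definition kernel_norm (x : kernel) : R := `|kernel_val x|.

Lemma kernel_normD x y : kernel_norm (x + y) <= kernel_norm x + kernel_norm y.
Proof. exact: ler_normD. Qed.

Lemma kernel_normZ a x : kernel_norm (a *: x) = `|a| * kernel_norm x.
Proof. exact: normrZ. Qed.

Lemma kernel_norm0 x : kernel_norm x = 0 -> x = 0.
Proof. by move/eqP; rewrite normr_eq0 => /eqP x0; apply: val_inj. Qed.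

HB.instance Definition _ := @Lmodule_isNormed.Build R kernel
  kernel_norm kernel_normD kernel_normZ kernel_norm0.

Lemma kernel_complete (F : set_system kernel) :
  ProperFilter F -> cauchy F -> cvg F.
Proof.
move=> FF Fc.
have Fe (e : R) : 0 < e -> exists f : kernel, F (ball f e).
  by move=> e0; have /cauchyP/(_ e e0) := Fc.
have cv : cvg (kernel_val @ F).
  apply/cauchy_cvgP/cauchyP => e e0; have [f Ff] := Fe e e0.
  exists (kernel_val f).
  change (F [set h | ball (kernel_val f) e (kernel_val h)]).
  by apply: filterS Ff => h; rewrite -!ball_normE.
have cF : kernel_val @ F --> lim (kernel_val @ F) by [].
have k0 : B (lim (kernel_val @ F)) = 0.
  have c1 : B \o kernel_val @ F --> B (lim (kernel_val @ F)).
    by apply: continuous_cvg => //; exact: bop_continuous.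
  have c2 : B \o kernel_val @ F --> 0.
    rewrite (_ : B \o kernel_val = cst 0); first exact: cvg_cst.
    by apply/funext => x; exact: (eqP (subspace_prop x)).
  by rewrite -(cvg_lim _ c1)// -(cvg_lim _ c2).
have kP : lim (kernel_val @ F) \in bker by exact/eqP.
apply/cvg_ex; exists (SubspaceOf kP : kernel).
apply/cvgrPdist_le => /= e e0.
by move/cvgrPdist_le : cF => /(_ e e0).
Qed.

HB.instance Definition _ := Uniform_isComplete.Build kernel kernel_complete.

End Kernel.

(** Functionals [g] with g \o A <= |.| are pointwise bounded on the kernel of
    [B], which is the range of [A]; hence they are uniformly bounded there, and
    [lift_of_dual_bound] applies.  The target of [A] is given as the kernel of
    [B] because the complexes only provide ranges in this form. *)
Lemma open_mapping (X Y : completeNormedModType R) (W : normedModType R)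
    (A : bop X Y) (B : bop Y W) :
  (forall x, B (A x) = 0) -> (forall y, B y = 0 -> exists x, A x = y) ->
  exists2 K, 0 <= K &
  forall y, B y = 0 -> exists x, A x = y /\ `|x| <= K * `|y|.
Proof.
move=> BA ex.
pose H := [set h : kernel B -> R^o | exists2 g : dual Y,
  forall x, g (A x) <= `|x| & h = fun y => g (kernel_val y)].
have gA (g : dual Y) : (forall x, g (A x) <= `|x|) ->
    forall x, `|g (A x)| <= `|x|.
  move=> gx x; rewrite ler_norml gx andbT lerNl -linearN -linearN.
  by rewrite (le_trans (gx _))// normrN.
have [||M HM] := @Banach_Steinhauss _ _ _ H _ _ 1.
- move=> _ [g _ ->]; split; last by move=> a x y; exact: (bop_linear g).
  apply: (@norm_bound_bounded _ _ _ (opnorm g)); first exact: opnorm_ge0.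
  by move=> x; exact: (le_opnorm g (kernel_val x)).
- move=> y; have [x xy] := ex _ (eqP (subspace_prop y)).
  by exists `|x| => _ [g /gA gx ->]; rewrite /kernel_val -xy gx.
pose K := Num.max M 0.
have K0 : 0 <= K by rewrite le_max lexx orbT.
exists (2 * (K + 1)); first by rewrite mulr_ge0// addr_ge0.
move=> y By; rewrite -mulrA; apply: (lift_of_dual_bound BA K0) => // h hA z Bz.
have [->|z0] := eqVneq z 0; first by rewrite linear0 normr0 mulr0.
have nz : 0 < `|z| by rewrite normr_gt0.
have kz : `|z|^-1 *: z \in bker B by apply/eqP; rewrite linearZ /= Bz scaler0.
have Hh : H (fun y => h (kernel_val y)) by exists h.
have := HM _ Hh (SubspaceOf kz : kernel B).
have -> : `|SubspaceOf kz : kernel B| = 1.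
  by rewrite [LHS]normrZ normfV normr_id mulVf// gt_eqF.
move=> /(_ (lexx _)); rewrite /kernel_val /= linearZ /= normrZ normfV normr_id.
rewrite ler_pdivrMl// => hz; apply: (le_trans (ler_norm _)).
by apply: (le_trans hz); rewrite mulrC ler_wpM2r// le_max lexx.
Qed.

End Functionals.

(** * Acyclicity of a Banach chain complex and of its dual *)

Section Acyclic.
Context {R : realType}.

Definition acyclic (E : banach_chain R) : Prop :=
  forall n (x : E n), is_cycle x -> exists y, x = bd E n y.

Definition coacyclic (E : banach_cochain R) : Prop :=
  forall n (x : E n), cobd E n x = 0 -> is_coboundary x.

(** Treats degree 0, where every element is a cycle, together with the
    others. *)
Lemma cycle_kernel (E : banach_chain R) n :
  exists (W : normedModType R) (B : bop (E n) W),
    forall x : E n, is_cycle x <-> B x = 0.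
Proof.
case: n => [|n]; last by exists (E n), (bd E n).
by exists (E 0%N), 0.
Qed.

Lemma bd_is_cycle (E : banach_chain R) n (x : E n.+1) : is_cycle (bd E n x).
Proof. by case: n x => [|n] x //=; rewrite bd_bd. Qed.

Lemma coboundary_cycle0 (E : banach_chain R) n (g : dual_chain E n) (z : E n) :
  is_coboundary g -> is_cycle z -> (g : dual (E n)) z = 0.
Proof.
case: n g z => [|n] g z /=; first by move=> ->.
by move=> [h ->] z0; rewrite dual_bopE z0 linear0.
Qed.

(** A linear functional below the linear functional [g] is [g] itself, so
    [fenchel_functional] with p = [g] extends the functional that [g] induces
    on the range of [A]. *)
Lemma functional_factor (X Y : normedModType R) (A : bop X Y) (g : dual X) K :
  0 <= K -> (forall x, `|g x| <= K * `|A x|) ->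
  exists h : dual Y, g = dual_bop A h.
Proof.
move=> K0 gK.
have sg : sublinear (g : X -> R).
  by split=> [x y|t x _]; rewrite ?linearD ?linearZ.
have pos x : 0 <= g x + K * `|A x|.
  by have := gK x; rewrite ler_norml; lra.
have [h [hA _ _]] := fenchel_functional 0 sg K0 pos.
exists h; apply: bopP => x; rewrite dual_bopE.
apply/eqP; rewrite eq_le hA andbT.
by have := hA (- x); rewrite !linearN lerN2.
Qed.

(** A cocycle [g] takes the same value at x and at a preimage of bd x of
    controlled norm, which gives the bound |g x| <= K |bd x| that
    [functional_factor] asks for. *)
Lemma acyclic_coacyclic (E : banach_chain R) :
  acyclic E -> coacyclic (dual_chain E).
Proof.
move=> aE [|n] g g0 /=.
  apply: bopP => y; have [//|x ->] := aE 0%N y.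
  by have := congr1 (fun h : dual _ => h x) g0.
have g0' x : (g : dual (E n.+1)) (bd E n.+1 x) = 0.
  by have := congr1 (fun h : dual _ => h x) g0.
have [W [B BP]] := cycle_kernel E n.
have [||K K0 HK] := open_mapping (A := bd E n) (B := B).
- by move=> x; apply/BP; exact: bd_is_cycle.
- by move=> y /BP /aE[x ->]; exists x.
apply: (functional_factor (K := opnorm (g : dual (E n.+1)) * K)).
  by rewrite mulr_ge0// opnorm_ge0.
move=> x; have /BP /HK[x' [xx' nx']] := bd_is_cycle x.
have [|y xy] := aE n.+1 (x - x').
  by rewrite /= linearB /= xx' subrr.
have -> : (g : dual (E n.+1)) x = (g : dual (E n.+1)) x'.
  by apply/eqP; rewrite -subr_eq0 -linearB xy; apply/eqP; exact: g0'.
apply: (le_trans (le_opnorm (g : dual (E n.+1)) x')).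
by rewrite -mulrA ler_wpM2l// opnorm_ge0.
Qed.

(** A functional [h] with h \o bd <= |.| differs by a coboundary from a lift
    h' of its coboundary with |h'| <= K.  Coboundaries vanish on cycles, so h
    and h' agree there. *)
Lemma coacyclic_acyclic (E : banach_chain R) :
  coacyclic (dual_chain E) -> acyclic E.
Proof.
move=> cE n z zc.
have [W [B BP]] := cycle_kernel E n.
have [||K K0 HK] :=
  open_mapping (A := dual_bop (bd E n)) (B := dual_bop (bd E n.+1)).
- by move=> h; exact: (dual_bd_bd h).
- by move=> h /(cE n.+1)[g hg]; exists g.
have BA x : B (bd E n x) = 0 by apply/BP; exact: bd_is_cycle.
suff [x [xz _]] : exists x, bd E n x = z /\ `|x| <= 2 * ((K + 1) * `|z|).
  by exists x.
apply: (lift_of_dual_bound BA K0); last exact/BP.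
move=> h hA y /BP yc.
have [|h' [hh' h'K]] := HK (dual_bop (bd E n) h); first exact: (dual_bd_bd h).
have h1 : `|dual_bop (bd E n) h| <= 1.
  apply: opnorm_le => // x; rewrite mul1r dual_bopE ler_norml hA andbT lerNl.
  by rewrite -!linearN (le_trans (hA _))// normrN.
have cb : is_coboundary (h - h' : dual_chain E n).
  apply: (cE n); apply: etrans (linearB (dual_bop (bd E n)) h h') _.
  by apply/eqP; rewrite subr_eq0 -[X in X == _]hh'.
have -> : h y = h' y.
  by apply/eqP; rewrite -subr_eq0; apply/eqP; exact: (coboundary_cycle0 cb yc).
apply: (le_trans (ler_norm _)); apply: (le_trans (le_opnorm h' y)).
rewrite ler_wpM2r//; apply: (le_trans h'K).
by rewrite ler_piMr.
Qed.

End Acyclic.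

(** * Products of Banach spaces *)

Section Product.
Context {R : realType}.
Implicit Types X Y Z : normedModType R.

Lemma bop_inl_linear X Y : linear (fun x : X => (x, 0) : X * Y).
Proof. by move=> a x y; apply/pair_equal_spec; rewrite /= scaler0 addr0. Qed.

Lemma bop_inl_bounded X Y : bounded_fun_norm (fun x : X => (x, 0) : X * Y).
Proof.
apply: (@norm_bound_bounded _ _ _ _ 1) => // x.
by rewrite mul1r prod_normE /= normr0 ge_max lexx normr_ge0.
Qed.

Definition bop_inl X Y : bop X (X * Y)%type :=
  mkbop (@bop_inl_linear X Y) (@bop_inl_bounded X Y).

Lemma bop_inr_linear X Y : linear (fun y : Y => (0, y) : X * Y).
Proof. by move=> a x y; apply/pair_equal_spec; rewrite /= scaler0 addr0. Qed.

Lemma bop_inr_bounded X Y : bounded_fun_norm (fun y : Y => (0, y) : X * Y).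
Proof.
apply: (@norm_bound_bounded _ _ _ _ 1) => // x.
by rewrite mul1r prod_normE /= normr0 ge_max lexx normr_ge0.
Qed.

Definition bop_inr X Y : bop Y (X * Y)%type :=
  mkbop (@bop_inr_linear X Y) (@bop_inr_bounded X Y).

Lemma bop_fst_linear X Y : linear (@fst X Y). Proof. by []. Qed.

Lemma bop_fst_bounded X Y : bounded_fun_norm (@fst X Y).
Proof.
apply: (@norm_bound_bounded _ _ _ _ 1) => // x.
by rewrite mul1r prod_normE le_max lexx.
Qed.

Definition bop_fst X Y : bop (X * Y)%type X :=
  mkbop (@bop_fst_linear X Y) (@bop_fst_bounded X Y).

Lemma bop_snd_linear X Y : linear (@snd X Y). Proof. by []. Qed.

Lemma bop_snd_bounded X Y : bounded_fun_norm (@snd X Y).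
Proof.
apply: (@norm_bound_bounded _ _ _ _ 1) => // x.
by rewrite mul1r prod_normE le_max lexx orbT.
Qed.

Definition bop_snd X Y : bop (X * Y)%type Y :=
  mkbop (@bop_snd_linear X Y) (@bop_snd_bounded X Y).

Definition bop_row X Y Z (u : bop X Z) (v : bop Y Z) : bop (X * Y)%type Z :=
  bop_comp u (bop_fst X Y) + bop_comp v (bop_snd X Y).

Definition bop_col X Y Z (u : bop Z X) (v : bop Z Y) : bop Z (X * Y)%type :=
  bop_comp (bop_inl X Y) u + bop_comp (bop_inr X Y) v.

Lemma bop_rowE X Y Z (u : bop X Z) (v : bop Y Z) x :
  bop_row u v x = u x.1 + v x.2.
Proof. by []. Qed.

Lemma bop_colE X Y Z (u : bop Z X) (v : bop Z Y) z :
  bop_col u v z = (u z, v z).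
Proof. by apply/pair_equal_spec; rewrite addr0 add0r. Qed.

End Product.

Section ProductComplete.
Context {R : realType}.

(* Supplies the pointed uniform structure on the product of two normed
   spaces, on which completeness is stated. *)
HB.instance Definition _ (X Y : normedModType R) :=
  NormedModule.copy (X * Y)%type (X * Y)%type.

Variables X Y : completeNormedModType R.

Lemma prod_complete (F : set_system (X * Y)%type) :
  ProperFilter F -> cauchy F -> cvg F.
Proof.
move=> FF /cauchyP Fc.
have cauchy_proj (Z : completeNormedModType R) (p : X * Y -> Z) :
    (forall x y e, ball x e y -> ball (p x) e (p y)) -> cvg (p @ F).
  move=> pb; apply/cauchy_cvgP/cauchyP => e /Fc[x Fx]; exists (p x).
  change (F [set y | ball (p x) e (p y)]).
  by apply: filterS Fx => y; exact: pb.
have c1 : cvg (fst @ F) by apply: cauchy_proj => x y e [].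
have c2 : cvg (snd @ F) by apply: cauchy_proj => x y e [].
apply/cvg_ex; exists (lim (fst @ F), lim (snd @ F)).
apply/cvgrPdist_lt => /= e e0.
have n1 : \forall z \near F, `|lim (fst @ F) - z.1| < e.
  by move/cvgrPdist_lt : c1; apply.
have n2 : \forall z \near F, `|lim (snd @ F) - z.2| < e.
  by move/cvgrPdist_lt : c2; apply.
by apply: filterS2 n1 n2 => z z1 z2; rewrite prod_normE gt_max z1.
Qed.

HB.instance Definition _ := Uniform_isComplete.Build (X * Y)%type prod_complete.

End ProductComplete.

(** * The mapping cone *)

Section Cone.
Context {R : realType} (C D : banach_chain R) (f : chain_mor C D).

Definition cone_obj n : completeNormedModType R :=
  if n is m.+1 then (C m * D m.+1)%type else D 0%N.

Definition cone_bd n : bop (cone_obj n.+1) (cone_obj n) :=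
  match n with
  | 0%N => bop_row (f 0%N) (bd D 0%N)
  | m.+1 => bop_col (bop_comp (- bd C m) (bop_fst _ _))
                    (bop_row (f m.+1) (bd D m.+1))
  end.

Lemma cone_bd_bd n x : cone_bd n (cone_bd n.+1 x) = 0.
Proof.
have fd m (c : C m.+1) (d : D m.+2) :
    f m (- bd C m c) + bd D m (f m.+1 c + bd D m.+1 d) = 0.
  by rewrite linearN /= chain_morE linearD /= bd_bd addr0 addNr.
case: n x => [|n] [c d]; rewrite /cone_bd !bop_colE; first exact: fd.
apply/pair_equal_spec; split; last exact: fd.
change (- bd C n (- bd C n.+1 c) = 0).
by rewrite linearN /= bd_bd !oppr0.
Qed.

Definition cone : banach_chain R := BanachChain cone_bd_bd.

Lemma cone_bd0 (c : C 0%N) (d : D 1%N) :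
  bd cone 0%N (c, d) = f 0%N c + bd D 0%N d.
Proof. by []. Qed.

Lemma cone_bdS n (c : C n.+1) (d : D n.+2) :
  bd cone n.+1 (c, d) = (- bd C n c, f n.+1 c + bd D n.+1 d).
Proof. exact: bop_colE. Qed.

Lemma cone_cycleP n (c : C n) (d : D n.+1) :
  @is_cycle _ cone n.+1 (c, d) <-> is_cycle c /\ f n c + bd D n d = 0.
Proof.
case: n c d => [|n] c d; rewrite /is_cycle.
  by rewrite cone_bd0; split=> [|[]].
rewrite cone_bdS; split=> [[/eqP + ->]|[-> ->]]; last by rewrite oppr0.
by rewrite oppr_eq0 => /eqP.
Qed.

Lemma acyclic_cone : acyclic cone <->
  (forall d : D 0%N, exists c d', d = f 0%N c + bd D 0%N d') /\
  (forall n (c : C n) (d : D n.+1), is_cycle c -> f n c + bd D n d = 0 ->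
    exists c' d', c = - bd C n c' /\ d = f n.+1 c' + bd D n.+1 d').
Proof.
split=> [aE|[a0 aS] [|n]].
- split=> [d|n c d cc fcd].
    by have [//|[c d'] ->] := aE 0%N d; exists c, d'.
  have [|[c' d']] := aE n.+1 (c, d); first exact/cone_cycleP.
  by rewrite cone_bdS => -[-> ->]; exists c', d'.
- by move=> d _; have [c [d' ->]] := a0 d; exists (c, d').
- move=> [c d] /cone_cycleP[cc fcd].
  have [c' [d' [-> ->]]] := aS n c d cc fcd.
  by exists (c', d'); rewrite cone_bdS.
Qed.

Let restrC n (G : dual (cone n.+1)) : dual (C n) :=
  dual_bop (bop_inl (C n) (D n.+1)) G.
Let restrD n (G : dual (cone n.+1)) : dual (D n.+1) :=
  dual_bop (bop_inr (C n) (D n.+1)) G.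

Let splitE n (G : dual (cone n.+1)) c d : G (c, d) = restrC G c + restrD G d.
Proof.
rewrite /restrC /restrD !dual_bopE -linearD; congr (G _).
by apply/pair_equal_spec; rewrite /= addr0 add0r.
Qed.

(** The two equations are the vanishing of [G] on the boundaries of the pairs
    (0, d) and (c, 0), which span the boundaries of the cone. *)
Lemma cone_cocycleP n (G : dual (cone n.+1)) :
  dual_bop (bd cone n.+1) G = 0 <->
  dual_bop (bd D n.+1) (restrD G) = 0 /\
  dual_bop (f n.+1) (restrD G) = dual_bop (bd C n) (restrC G).
Proof.
have E c d : dual_bop (bd cone n.+1) G (c, d) =
    restrD G (f n.+1 c) - restrC G (bd C n c) + restrD G (bd D n.+1 d).
  rewrite dual_bopE cone_bdS splitE linearN linearD /= addrA.
  by rewrite (addrC (- _)).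
split=> [G0|[h1 h2]].
  have E0 c d := etrans (esym (E c d)) (congr1 (fun k : dual _ => k (c, d)) G0).
  split; apply: bopP => x; rewrite !dual_bopE.
    by have := E0 0 x; rewrite !linear0 !add0r.
  by have := E0 x 0; rewrite !linear0 addr0 => /eqP; rewrite subr_eq0 => /eqP.
apply: bopP => -[c d]; rewrite E -!dual_bopE h1 h2 subrr add0r.
by [].
Qed.

(** Stated through [is_coboundary] on the dual of [C], which absorbs the
    component of the preimage on [C] and covers degree 0, where the cone has no
    such component. *)
Lemma cone_coboundaryP n (G : dual (cone n.+1)) :
  is_coboundary (G : dual_chain cone n.+1) <->
  exists h, restrD G = dual_bop (bd D n) h /\
    is_coboundary (dual_bop (f n) h - restrC G : dual_chain C n).
Proof.
case: n G => [|n] G; split.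
- move=> [h Gh]; exists h.
  have E c d : restrC G c + restrD G d =
      (h : dual (D 0%N)) (f 0%N c + bd D 0%N d).
    by rewrite -splitE Gh.
  split; apply: bopP => x.
    by have := E 0 x; rewrite !linear0 !add0r.
  have := E x 0; rewrite !linear0 !addr0 => e.
  by change ((h : dual (D 0%N)) (f 0%N x) - restrC G x = 0); rewrite e subrr.
- move=> [h [h2 /eqP]]; rewrite subr_eq0 => /eqP h1.
  exists h; apply: bopP => -[c d].
  by rewrite splitE h2 -h1 !dual_bopE -linearD.
- move=> [H GH]; exists (restrD H).
  have E c d : restrC G c + restrD G d =
      restrD H (f n.+1 c) - restrC H (bd C n c) + restrD H (bd D n.+1 d).
    rewrite -splitE GH dual_bopE cone_bdS splitE linearN linearD /= addrA.
    by rewrite (addrC (- _)).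
  split; first apply: bopP => x.
    by have := E 0 x; rewrite !linear0 !add0r.
  exists (restrC H); apply: bopP => x.
  have := E x 0; rewrite !linear0 !addr0 => e.
  change (restrD H (f n.+1 x) - restrC G x = restrC H (bd C n x)).
  by rewrite e opprB addrCA subrr addr0.
- move=> [h [h2 [g h1]]].
  exists (bop_row g h); apply: bopP => -[c d].
  rewrite splitE h2.
  have -> : restrC G = dual_bop (f n.+1) h - dual_bop (bd C n) g.
    by rewrite -[dual_bop (bd C n) g]h1 opprB addrCA subrr addr0.
  change (h (f n.+1 c) - (g : dual (C n)) (bd C n c) + h (bd D n.+1 d) =
    bop_row (g : dual (C n)) h (bd cone n.+1 (c, d))).
  by rewrite cone_bdS bop_rowE /= linearN linearD /= addrA (addrC (- _)).
Qed.

Lemma coacyclic_cone : coacyclic (dual_chain cone) <->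
  (forall h : dual (D 0%N), dual_bop (bd D 0%N) h = 0 ->
    dual_bop (f 0%N) h = 0 -> h = 0) /\
  (forall n (g : dual (C n)) (h : dual (D n.+1)), dual_bop (bd D n.+1) h = 0 ->
    dual_bop (f n.+1) h = dual_bop (bd C n) g ->
    exists h', h = dual_bop (bd D n) h' /\
      is_coboundary (dual_bop (f n) h' - g : dual_chain C n)).
Proof.
split=> [aE|[a0 aS] [|n]].
- split=> [h hd hf|n g h hd hg].
    apply: (aE 0%N h); apply: bopP => -[c d].
    rewrite dual_bopE cone_bd0 linearD /= -!dual_bopE hd hf.
    by rewrite !bop0 addr0.
  pose G : dual (cone n.+1) := bop_row g h.
  have e1 : restrC G = g.
    by apply: bopP => c; rewrite dual_bopE bop_rowE /= linear0 addr0.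
  have e2 : restrD G = h.
    by apply: bopP => c; rewrite dual_bopE bop_rowE /= linear0 add0r.
  have : is_coboundary (G : dual_chain cone n.+1).
    by apply: (aE n.+1); apply/cone_cocycleP; rewrite e1 e2.
  by move=> /cone_coboundaryP[h']; rewrite e1 e2; exists h'.
- move=> h hE.
  have E c d : (h : dual (D 0%N)) (f 0%N c + bd D 0%N d) = 0.
    have e : forall k : dual (cone 1%N), k = 0 -> k (c, d) = 0 by move=> k ->.
    exact: (e _ hE).
  apply: a0; apply: bopP => x.
    by have := E 0 x; rewrite linear0 add0r.
  by have := E x 0; rewrite linear0 addr0.
- by move=> G /cone_cocycleP[h1 h2]; apply/cone_coboundaryP; exact: aS.
Qed.

End Cone.

(** * Subquotients *)

Section Subquot.
Context {R : realType}.

Lemma submod_rpredB (V : lmodType R) (S : submodClosed V) x y :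
  x \in S -> y \in S -> x - y \in S.
Proof. by move=> xS yS; rewrite -scaleN1r rpredD// rpredZ. Qed.

(** Reduces statements about quotients to statements about representatives. *)
Lemma subquot_map_bijective (V W : normedModType R) (Z B : submodClosed V)
    (Z' B' : submodClosed W) (f : {linear V -> W})
    (fZ : {in Z, forall x, f x \in Z'}) (fB : {in B, forall x, f x \in B'}) :
  bijective (subquot_map B' fZ : subquot Z B -> _) <->
  (forall x, x \in Z -> f x \in B' -> x \in B) /\
  (forall y, y \in Z' -> exists2 x, x \in Z & y - f x \in B').
Proof.
split=> [[g fK gK]|[inj sur]].
  split=> [x xZ fxB|y yZ].
    have e : subquot_map B' fZ (subquot_class B (SubspaceOf xZ)) =
        subquot_map B' fZ (subquot_class B 0).
      rewrite !(subquot_mapE fZ fB); apply/subquot_classP.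
      by rewrite /= linear0 subr0.
    by have /subquot_classP := can_inj fK e; rewrite /= subr0.
  have := gK (subquot_class B' (SubspaceOf yZ)).
  rewrite -{1}[g _]subquot_reprK (subquot_mapE fZ fB) => /esym/subquot_classP h.
  by exists (val (subquot_repr (g (subquot_class B' (SubspaceOf yZ)))));
    [exact: subspace_prop|].
have fI : injective (subquot_map B' fZ : subquot Z B -> _).
  move=> u v; rewrite -[u]subquot_reprK -[v]subquot_reprK !(subquot_mapE fZ fB).
  set z := subquot_repr u; set t := subquot_repr v.
  move=> /subquot_classP /=; rewrite -linearB => h; apply/subquot_classP.
  by apply: inj => //; apply: submod_rpredB; exact: subspace_prop.
have /choice[g gP] : forall v : subquot Z' B',
    exists u : subquot Z B, subquot_map B' fZ u = v.
  move=> v.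
  rewrite -[v]subquot_reprK; set t := subquot_repr v.
  have [x xZ xB] := sur (val t) (subspace_prop t).
  exists (subquot_class B (SubspaceOf xZ)); rewrite (subquot_mapE fZ fB).
  by apply/esym/subquot_classP.
by exists g => // u; apply: fI; rewrite gP.
Qed.

Section Seminorm.
Variables (V : normedModType R) (Z B : submodClosed V).

Lemma subquot_seminorm_le (u : subquot Z B) z :
  subquot_class B z = u -> subquot_seminorm u <= `|val z|.
Proof.
move=> zu; apply: ge_inf; last by exists z.
by exists 0 => _ [t _ <-].
Qed.

Lemma subquot_seminorm_ge (u : subquot Z B) c :
  (forall z, subquot_class B z = u -> c <= `|val z|) -> c <= subquot_seminorm u.
Proof.
move=> h; apply: lb_le_inf; last by move=> _ [z zu <-]; exact: h.
by exists `|val (subquot_repr u)|, (subquot_repr u) => //; exact: subquot_reprK.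
Qed.

Lemma subquot_seminorm_ge0 (u : subquot Z B) : 0 <= subquot_seminorm u.
Proof. by apply: subquot_seminorm_ge. Qed.

Lemma subquot_seminorm_geM (u : subquot Z B) c m : 0 <= m ->
  (forall z, subquot_class B z = u -> c <= m * `|val z|) ->
  c <= m * subquot_seminorm u.
Proof.
rewrite le_eqVlt => /orP[/eqP <-|m0] h.
  by rewrite mul0r; have := h _ (subquot_reprK u); rewrite mul0r.
rewrite -ler_pdivrMl//; apply: subquot_seminorm_ge => z zu.
by rewrite ler_pdivrMl// h.
Qed.

End Seminorm.
End Subquot.

(** * Isomorphisms in homology and acyclicity of the cone *)

Section Iso.
Context {R : realType}.

(** A pair of the cone is a cycle when c is a cycle whose image under f is the
    boundary of - d.  Injectivity in degree n makes c a boundary; the rest of d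
    is then a cycle, which surjectivity in degree n + 1 represents by the image
    of a cycle. *)
Lemma homology_isoP (C D : banach_chain R) (f : chain_mor C D) :
  homology_iso f <-> acyclic (cone f).
Proof.
pose inj n := forall c : C n, is_cycle c ->
  (exists d, f n c = bd D n d) -> exists c', c = bd C n c'.
pose sur n := forall d : D n, is_cycle d ->
  exists c, is_cycle c /\ exists d', d - f n c = bd D n d'.
have bijP n := subquot_map_bijective (@chain_mor_cycle _ C D f n)
  (@chain_mor_boundary _ C D f n).
have isoP : homology_iso f <-> forall n, inj n /\ sur n.
  split=> h n; [have [i s] := (bijP n).1 (h n)
               |have [i s] := h n; apply/(bijP n).2]; split.
  - by move=> c /asboolP cc /asboolP fc; exact/asboolP/i.
  - move=> d /asboolP dc; have [c /asboolP cc /asboolP fc] := s d dc.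
    by exists c.
  - by move=> c /asboolP cc /asboolP fc; apply/asboolP/i.
  - move=> d /asboolP dc; have [c [cc fc]] := s d dc.
    by exists c; exact/asboolP.
apply: (iff_trans isoP); apply: iff_trans (iff_sym (acyclic_cone f)).
split=> [h|[h0 hS] n].
  split=> [d|n c d cc fcd].
    have [_ /(_ d Logic.I)[c [_ [d' dE]]]] := h 0%N.
    by exists c, d'; rewrite -dE addrC subrK.
  have [i _] := h n; have [_ s] := h n.+1.
  have [|c0 cE] := i c cc.
    exists (- d); rewrite linearN.
    by apply/eqP; rewrite -subr_eq0 opprK fcd.
  have [|z [zc [d' dE]]] := s (d + f n.+1 c0).
    by rewrite /= linearD /= -chain_morE -cE addrC.
  exists (z - c0), d'; split.
    by rewrite linearB /= (zc : bd C n z = 0) sub0r opprK.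
  by rewrite linearB /= -dE addrC addrA subrK addrK.
split=> [c cc [d fc]|].
  have [|c' [d' [-> _]]] := hS n c (- d) cc.
    by rewrite linearN /= fc subrr.
  by exists (- c'); rewrite linearN.
case: n => [|n] d dc.
  have [c [d' ->]] := h0 d; exists c; split=> //; exists d'.
  by rewrite addrC addKr.
have [||c [d' [cE ->]]] := hS n 0 d.
- by case: (n) => //= m; rewrite linear0.
- by rewrite linear0 add0r.
exists c; split; last by exists d'; rewrite addrC addKr.
by apply/eqP; rewrite -oppr_eq0 -cE.
Qed.

(** The cochain form of the same chase; its right-hand side is the form that
    acyclicity of the dual cone takes. *)
Lemma cohomology_isoP (A B : banach_cochain R) (F : cochain_mor A B) :
  cohomology_iso F <->
  (forall x : A 0%N, cobd A 0%N x = 0 -> F 0%N x = 0 -> x = 0) /\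
  (forall n (y : B n) (x : A n.+1), cobd A n.+1 x = 0 ->
    F n.+1 x = cobd B n y ->
    exists x', x = cobd A n x' /\ is_coboundary (F n x' - y)).
Proof.
pose inj n := forall x : A n, cobd A n x = 0 ->
  is_coboundary (F n x) -> is_coboundary x.
pose sur n := forall y : B n, cobd B n y = 0 ->
  exists x, cobd A n x = 0 /\ is_coboundary (y - F n x).
have bijP n := subquot_map_bijective (@cochain_mor_cocycle _ A B F n)
  (@cochain_mor_coboundary _ A B F n).
have isoP : cohomology_iso F <-> forall n, inj n /\ sur n.
  split=> h n; [have [i s] := (bijP n).1 (h n)
               |have [i s] := h n; apply/(bijP n).2]; split.
  - by move=> c /asboolP cc /asboolP fc; exact/asboolP/i.
  - move=> d /asboolP dc; have [c /asboolP cc /asboolP fc] := s d dc.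
    by exists c.
  - by move=> c /asboolP cc /asboolP fc; apply/asboolP/i.
  - move=> d /asboolP dc; have [c [cc fc]] := s d dc.
    by exists c; exact/asboolP.
have cobN n (y : B n) : is_coboundary y -> is_coboundary (- y).
  move=> yb; have /asboolP : - y \in @coboundary _ B n; last by [].
  by rewrite -scaleN1r rpredZ//; exact/asboolP.
apply: (iff_trans isoP); split=> [h|[h0 hS] n].
  split=> [|n y x xc xy]; first exact: (h 0%N).1.
  have [|x0 xE] := (h n.+1).1 x xc; first by exists y.
  have [|z [zc zE]] := (h n).2 (y - F n x0).
    by rewrite linearB /= -xy -cochain_morE -xE subrr.
  exists (x0 + z); split; first by rewrite linearD /= zc addr0.
  have -> : F n (x0 + z) - y = - (y - F n x0 - F n z).
    by rewrite -addrA -opprD opprB linearD.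
  exact: cobN.
split=> [|y yc].
  case: n => [|n] x xc xy; first exact: h0.
  by have [y xE] := xy; have [x' [-> _]] := hS n y x xc xE; exists x'.
have [||x' [/esym xc xE]] := hS n y 0; rewrite ?linear0//.
by exists x'; split=> //; rewrite -opprB; exact: cobN.
Qed.

Lemma homology_iso_dual (C D : banach_chain R) (f : chain_mor C D) :
  homology_iso f <-> cohomology_iso (dual_mor f).
Proof.
apply: (iff_trans (homology_isoP f)).
apply: iff_trans (iff_sym (cohomology_isoP (dual_mor f))).
apply: iff_trans (coacyclic_cone f).
by split; [exact: acyclic_coacyclic|exact: coacyclic_acyclic].
Qed.

End Iso.

(** * Isometries *)

Section Isometry.
Context {R : realType}.

(** The value does not depend on the representatives, so both norms may be
    minimised. *)
Lemma pairing_le (C : banach_chain R) n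
    (k : subspace_of (@cocycle _ (dual_chain C) n))
    (z : subspace_of (@Defs.cycle _ C n)) :
  (val k : dual (C n)) (val z) <=
  cohomology_seminorm (subquot_class (@coboundary _ (dual_chain C) n) k) *
  homology_seminorm (subquot_class (@boundary _ C n) z).
Proof.
apply: subquot_seminorm_geM => [|z' zz']; first exact: subquot_seminorm_ge0.
rewrite mulrC; apply: subquot_seminorm_geM => // k' kk'.
have -> : (val k : dual (C n)) (val z) = (val k' : dual (C n)) (val z').
  have /asboolP kc := subspace_prop k; have /asboolP zc := subspace_prop z'.
  have /subquot_classP/asboolP[y yE] := zz'.
  have /subquot_classP/asboolP hE := kk'.
  have e1 : (val k : dual (C n)) (val z') = (val k : dual (C n)) (val z).
    apply/eqP; rewrite -subr_eq0 -linearB yE; apply/eqP.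
    have e : forall h : dual (C n.+1), h = 0 -> h y = 0 by move=> h ->.
    exact: (e _ kc).
  rewrite -e1; apply/esym/eqP; rewrite -subr_eq0; apply/eqP.
  exact: (coboundary_cycle0 hE zc).
apply: (le_trans (ler_norm _)); rewrite mulrC.
exact: (le_opnorm (val k' : dual (C n))).
Qed.

(** With p = 0 and M = 1, [fenchel_functional] gives a functional that
    vanishes on the boundaries and whose value at z is the distance from z to
    them, which is the semi-norm of the class of z. *)
Lemma norming_cocycle (C : banach_chain R) n
    (z : subspace_of (@Defs.cycle _ C n)) :
  exists k : subspace_of (@cocycle _ (dual_chain C) n),
    cohomology_seminorm (subquot_class (@coboundary _ (dual_chain C) n) k) <= 1
    /\
    homology_seminorm (subquot_class (@boundary _ C n) z) <=
      (val k : dual (C n)) (val z).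
Proof.
have s0 : sublinear (fun _ : C n.+1 => 0 : R).
  by split=> [x y|t x _]; rewrite ?addr0 ?mulr0.
have pos (x : C n.+1) : 0 <= 0 + 1 * `|bd C n x| by rewrite add0r mul1r.
have [h [hA h1 hz]] := fenchel_functional (val z) s0 ler01 pos.
have hc : (h : dual_chain C n) \in @cocycle _ (dual_chain C) n.
  apply/asboolP; apply: bopP => x; rewrite bop0.
  apply/eqP; rewrite eq_le; apply/andP; split; first exact: hA.
  by have := hA (- x); rewrite !linearN oppr_le0.
exists (SubspaceOf hc); split.
  apply: le_trans h1.
  exact: (subquot_seminorm_le (z := SubspaceOf hc) erefl).
apply: le_trans hz; apply: infconv_ge => x; rewrite add0r mul1r.
have zc : val z - bd C n x \in @Defs.cycle _ C n.
  apply: submod_rpredB; first exact: subspace_prop.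
  by apply: boundary_cycle; apply/asboolP; exists x.
apply: (@subquot_seminorm_le _ _ _ _ _ (SubspaceOf zc)).
apply/subquot_classP; apply/asboolP; exists (- x).
by rewrite /= addrAC subrr add0r linearN.
Qed.

Lemma homology_isometric_dual (C D : banach_chain R) (f : chain_mor C D) :
  cohomology_iso (dual_mor f) -> cohomology_isometric (dual_mor f) ->
  homology_isometric f.
Proof.
move=> iso isom n a; rewrite -[a]subquot_reprK; set z := subquot_repr a.
have fE : homology_map f n (subquot_class (@boundary _ C n) z) =
  subquot_class (@boundary _ D n) (subspace_map (@chain_mor_cycle _ C D f n) z).
  exact: (subquot_mapE (@chain_mor_cycle _ C D f n)
    (@chain_mor_boundary _ C D f n)).
have gE (g : subspace_of (@cocycle _ (dual_chain D) n)) :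
  cohomology_map (dual_mor f) n (subquot_class (@coboundary _ _ n) g) =
  subquot_class (@coboundary _ _ n)
    (subspace_map (@cochain_mor_cocycle _ _ _ (dual_mor f) n) g).
  exact: (subquot_mapE (@cochain_mor_cocycle _ _ _ (dual_mor f) n)
    (@cochain_mor_coboundary _ _ _ (dual_mor f) n)).
rewrite fE; apply/eqP; rewrite eq_le; apply/andP; split.
  have [g [g1 gz]] :=
    norming_cocycle (subspace_map (@chain_mor_cycle _ C D f n) z).
  apply: (le_trans gz).
  have := pairing_le
    (subspace_map (@cochain_mor_cocycle _ _ _ (dual_mor f) n) g) z.
  rewrite -gE isom => /le_trans; apply.
  by rewrite ler_piMl// subquot_seminorm_ge0.
have [k [k1 kz]] := norming_cocycle z; apply: (le_trans kz).
have [F' F'K FK] := iso n.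
set b := subquot_class _ k in k1 *.
have bE := FK b; rewrite -[F' b]subquot_reprK gE in bE.
set g := subquot_repr (F' b) in bE.
have kg : (val k : dual (C n)) (val z) = (val g : dual (D n)) (f n (val z)).
  have /subquot_classP/asboolP hE := bE.
  have /asboolP zc := subspace_prop z.
  apply/esym/eqP; rewrite -subr_eq0; apply/eqP.
  exact: (coboundary_cycle0 hE zc).
rewrite kg; have := pairing_le g (subspace_map (@chain_mor_cycle _ C D f n) z).
move=> /le_trans; apply; rewrite ler_piMl ?subquot_seminorm_ge0//.
by rewrite -isom gE bE.
Qed.

End Isometry.

Theorem theorem1p1 (R : realType) (C D : banach_chain R) (f : chain_mor C D) :
  (homology_iso f <-> cohomology_iso (dual_mor f)) /\
  (cohomology_iso (dual_mor f) /\ cohomology_isometric (dual_mor f) ->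
   homology_iso f /\ homology_isometric f).
Proof.
split=> [|[iso isom]]; first exact: homology_iso_dual.
by split; [exact/homology_iso_dual|exact: homology_isometric_dual].
Qed.
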